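(* Let $\mu$ and $\nu$ be partitions. If $T$ is a plethystic semistandard tableau of shape $\mu^\nu$ whose weight is maximal in the dominance order among the weights of plethystic semistandard tableaux of shape $\mu^\nu$, then $\mathrm{wt}(T)$ is a partition.
   Context: A tableau with entries in a totally ordered set is semistandard if its rows are weakly increasing from left to right and its columns strictly increasing from top to bottom. Let $\mathrm{SSYT}_{\mathbf{N}}(\mu)$ be the set of semistandard $\mu$-tableaux with entries from $\mathbf{N}=\{1,2,\ldots\}$, totally ordered by: $t<u$ if and only if, in the rightmost column in which $t$ and $u$ differ, the greatest entry not appearing in both columns lies in $u$. A plethystic semistandard tableau of shape $\mu^\nu$ is a semistandard $\nu$-tableau with entries in $\mathrm{SSYT}_{\mathbf{N}}(\mu)$. Its weight $\mathrm{wt}(T)$ is the composition $(\beta_1,\ldots,\beta_M)$ where $M$ is the greatest integer appearing in its $\mu$-tableau entries and $\beta_b$ is the total number of occurrences of $b$ in its $\mu$-tableau entries. Dominance order on compositions: $\beta\unrhd\gamma$ if $\beta_1+\cdots+\beta_i\ge\gamma_1+\cdots+\gamma_i$ for all $i$, parts beyond the last being $0$. *)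

(* Defs.v *)
From mathcomp Require Import all_boot.
Set Implicit Arguments.
Unset Strict Implicit.
Unset Printing Implicit Defensive.

Definition is_partition (p : seq nat) : bool := sorted geq p && (0 \notin p).

Section Tableaux.
Variable T : eqType.

(* A tableau is the list of its rows, from top to bottom (English notation). *)
Definition tableau := seq (seq T).

(* Column [j] (counted from 0), read from top to bottom. *)
Definition column (j : nat) (t : tableau) : seq T :=
  pmap (fun r : seq T => onth r j) t.

Definition width (t : tableau) : nat := \max_(r <- t) size r.

(* [lt] is the strict order on the entries; it is meant to be a strict total
   order on those that actually occur. *)
Definition semistandard (lt : rel T) (la : seq nat) (t : tableau) : bool :=
  [&& shape t == la,
      all (sorted (fun x y => (x == y) || lt x y)) t
    & all (fun j => sorted lt (column j t)) (iota 0 (width t))].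

End Tableaux.

Definition SSYT (mu : seq nat) : pred (tableau nat) :=
  fun t => semistandard ltn mu t && all (leq 1) (flatten t).

(* The greatest entry not appearing in both [c] and [d] exists and lies in
   [d]; in particular [c] and [d] differ. *)
Definition column_lt (c d : seq nat) : bool :=
  has (fun x => (x \notin c) &&
         all (fun y => ~~ ((y \in c) && (y \in d)) ==> (y <= x)) (c ++ d)) d.

(* [j] is the rightmost column in which [t] and [u] differ. This is a total
   order only on semistandard tableaux of a common shape. *)
Definition tableau_lt (t u : tableau nat) : bool :=
  has (fun j => column_lt (column j t) (column j u) &&
         all (fun k => (j < k) ==> (column k t == column k u))
             (iota 0 (width t)))
      (iota 0 (width t)).

Definition plethystic_semistandard (mu nu : seq nat)
    (T : tableau (tableau nat)) : bool :=
  semistandard tableau_lt nu T && all (SSYT mu) (flatten T).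

(* All integers occurring in the inner tableaux, with multiplicity. *)
Definition entries (T : tableau (tableau nat)) : seq nat :=
  flatten (flatten (flatten T)).

Definition wt (T : tableau (tableau nat)) : seq nat :=
  [seq count_mem b (entries T) | b <- iota 1 (\max_(x <- entries T) x)].

(* [take i] returns the whole list when [i] exceeds its size, so parts beyond
   the last count as 0. *)
Definition dominates (beta gamma : seq nat) : Prop :=
  forall i : nat, sumn (take i gamma) <= sumn (take i beta).

(* Main.v *)
Require Import Defs.
From mathcomp Require Import all_boot zify.

Set Implicit Arguments.
Unset Strict Implicit.
Unset Printing Implicit Defensive.

(** Suppose that wt(T) is not weakly decreasing, say b occurs less often than
    b + 1. It suffices to find a plethystic semistandard tableau T' in which the
    numbers of occurrences of b and b + 1 are exchanged and all others are kept:
    its weight strictly dominates wt(T), against maximality. A weakly decreasing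
    weight has no zero part because its last part counts the greatest entry.

    The tableau T' comes from two applications of the Bender-Knuth involutions,
    which show that the Schur functions for mu and for nu are symmetric.

    - Inside: the involution phi = bender_knuth b permutes the semistandard
      mu-tableaux and exchanges the multiplicities of b and b + 1. Applying phi
      to every inner tableau of T gives the right weight, but the
      outer tableau may cease to be semistandard, since phi does not preserve
      the order on mu-tableaux.

    - Outside: this is repaired by semistandard_permute_entries. For entries in
      any totally ordered set, whether a semistandard nu-tableau with given
      multiplicities exists does not depend on which entry carries which
      multiplicity: relabel the entries by their ranks 0, 1, ...; adjacent
      multiplicities can be exchanged by Bender-Knuth involutions, and adjacent
      exchanges generate all permutations. So some semistandard nu-tableau has
      as entries exactly the images under phi of the entries of T; here it
      matters that phi is injective. This is T'.

    For the second step the order on mu-tableaux must be total and transitive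
    on SSYT mu. It compares finite sets of cells lexicographically, so both
    properties reduce to looking at the last place of difference.

    Bender-Knuth involutions are built from the numbers g(k, i) of entries less
    than k in row i, that is, from Gelfand-Tsetlin patterns. Column strictness
    is the interlacing g(k+1, i+1) <= g(k, i), and the involution replaces the
    single row g(b+1, .) of the pattern by its reflection in the intervals that
    interlacing leaves to it. Semistandardness and involutivity are then
    immediate, and the exchange of multiplicities is a telescoping sum. *)

(** * Columns and the entrywise form of semistandardness *)

Section Columns.
Variables (T : eqType) (x0 : T).
Implicit Types (t u : tableau T) (la : seq nat).

Definition entry t i j := nth x0 (nth [::] t i) j.

(** The rows of length greater than j are the topmost ones, because the shape is
    weakly decreasing; hence a column is an initial segment of rows, with no
    gaps. *)
Lemma ltn_col_height t i j : sorted geq (shape t) ->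
  (i < count (fun r => j < size r) t) = (j < size (nth [::] t i)).
Proof.
elim: t i => [|r t IH] i /=; first by rewrite nth_nil.
rewrite path_sortedE; last by move=> a b c /=; lia.
case/andP=> /allP le_r /IH{}IH; case: (ltnP j (size r)) => jr.
  by case: i => [|i] //=; rewrite ltnS IH.
have c0: count (fun r => j < size r) t = 0.
  apply/eqP; rewrite -leqn0 leqNgt -has_count; apply/hasPn=> s ts.
  by rewrite -leqNgt; apply: leq_trans jr; exact: le_r (map_f size ts).
case: i => [|i] /=; first by rewrite c0 [RHS]ltnNge jr.
by rewrite -IH c0.
Qed.

Lemma columnE t j : sorted geq (shape t) ->
  column j t = mkseq (fun i => entry t i j) (count (fun r => j < size r) t).
Proof.
elim: t => [//|r t IH] sh /=; have sh': sorted geq (shape t) := path_sorted sh.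
case: (ltnP j (size r)) => jr.
  have -> : onth r j = Some (nth x0 r j).
    by rewrite onthE (nth_map x0).
  by rewrite /= add1n /mkseq /= -[1]addn0 iotaDl -map_comp IH.
have := ltn_col_height 0 j sh; rewrite /= [j < size r]ltnNge jr /= add0n.
by rewrite onth_default //= IH //; case: (count _ t).
Qed.

Lemma ltn_width t i j : j < size (nth [::] t i) -> j < width t.
Proof.
move=> jr; apply: leq_trans jr _; rewrite /width.
elim: t i => [|r t IH] [|i] //=; rewrite big_cons leq_max ?leqnn //.
by rewrite IH orbT.
Qed.

(** Columns are lists obtained by skipping short rows; this is the same
    condition in terms of vertically adjacent cells. *)
Lemma semistandardP lt la t : sorted geq la ->
  reflect [/\ shape t = la, all (sorted (fun x y => (x == y) || lt x y)) t
            & forall i j, j < size (nth [::] t i.+1) ->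
                lt (entry t i j) (entry t i.+1 j)]
          (semistandard lt la t).
Proof.
move=> la_sorted; apply: (iffP and3P) => -[].
  move=> /eqP sh rows /allP cols; split=> // i j jr.
  have := cols j; rewrite mem_iota add0n leq0n => /(_ (ltn_width jr)).
  have iC : i.+1 < count (fun r => j < size r) t by rewrite ltn_col_height ?sh.
  rewrite columnE ?sh // => /(sortedP x0)/(_ i).
  by rewrite size_mkseq => /(_ iC); rewrite !nth_mkseq // ltnW.
move=> sh rows cols; split=> //; first by rewrite sh.
apply/allP=> j _; rewrite columnE ?sh //; apply/(sortedP x0) => i.
rewrite size_mkseq => iC; have := iC; rewrite ltn_col_height ?sh // => /cols.
by rewrite !nth_mkseq // ltnW.
Qed.

Lemma tableau_ext t u : sorted geq (shape t) -> shape t = shape u ->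
  (forall j, j < width t -> column j t = column j u) -> t = u.
Proof.
move=> sh_t tu eq_col.
have sh_u: sorted geq (shape u) by rewrite -tu.
have size_row i : size (nth [::] t i) = size (nth [::] u i).
  by rewrite -!nth_shape tu.
apply: (@eq_from_nth _ [::]).
  by rewrite -[size t](size_map size) -/(shape t) tu size_map.
move=> i _; apply: (@eq_from_nth _ x0); first exact: size_row.
move=> j jr; have := eq_col j (ltn_width jr); rewrite !columnE //.
move/(congr1 (nth x0 ^~ i)) => /=.
by rewrite !nth_mkseq // ltn_col_height // -size_row.
Qed.

End Columns.

(** * The order on the inner tableaux *)

(** Without the bounded quantifiers: the last place at which the indicator
    functions of c and d differ, if there is one, belongs to d. *)
Lemma column_ltP c d :
  reflect (exists x, [/\ x \in d, x \notin c
                       & forall y, x < y -> (y \in c) = (y \in d)])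
          (column_lt c d).
Proof.
apply: (iffP hasP) => [[x xd /andP[xNc /allP top]]|[x [xd xNc top]]].
  exists x; split=> // y xy; have := top y; rewrite mem_cat.
  by case: (y \in c) (y \in d) => [] [] //= /(_ isT); rewrite leqNgt xy.
exists x => //; rewrite xNc; apply/allP => y; rewrite mem_cat => ycd.
apply/implyP; apply: contraR; rewrite -ltnNge => /top eq_y.
by move: ycd; rewrite eq_y orbb => ->.
Qed.

Lemma column_ltxx c : column_lt c c = false.
Proof. by apply/column_ltP => -[x [xc /negP]]. Qed.

(** If x and y decide the two comparisons, then max x y decides the composite
    one; x = y is impossible, since the middle column contains x but not y. *)
Lemma column_lt_trans : transitive column_lt.
Proof.
move=> d c e /column_ltP[x [xd xNc cd]] /column_ltP[y [ye yNd de]].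
have neq_xy : x != y by apply: contraNneq yNd => <-.
apply/column_ltP; exists (maxn x y).
case: (ltnP x y) => xy; split=> //.
- by rewrite cd.
- by move=> z yz; rewrite cd ?de // (ltn_trans xy).
- by rewrite -de // ltn_neqAle eq_sym neq_xy.
by move=> z xz; rewrite cd ?de // (leq_ltn_trans xy).
Qed.

Lemma column_lt_total c d : sorted ltn c -> sorted ltn d -> c != d ->
  column_lt c d || column_lt d c.
Proof.
move=> c_sorted d_sorted.
apply: contraR => /norP[/column_ltP Ncd /column_ltP Ndc].
apply/eqP/(irr_sorted_eq ltn_trans ltnn) => // x; apply/eqP/negPn/negP => x_diff.
(* The greatest entry on which the two columns disagree decides. *)
have exP : exists x, (x \in c) != (x \in d) by exists x.
have ubP y : (y \in c) != (y \in d) -> y <= sumn (c ++ d).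
  have le_sumn s : y \in s -> y <= sumn s.
    by move=> ys; rewrite (perm_sumn (perm_to_rem ys)) leq_addr.
  move=> y_diff; apply: le_sumn; rewrite mem_cat.
  by case: (y \in c) y_diff => //= /negPn ->.
case: (ex_maxnP exP ubP) => m m_diff max_m.
have top y : m < y -> (y \in c) = (y \in d).
  by move=> my; apply/eqP; apply: contraTT my => /max_m; rewrite -leqNgt.
case mc: (m \in c) m_diff; case md: (m \in d) => // _.
  by case: Ndc; exists m; rewrite mc md; split=> // y /top.
by case: Ncd; exists m; rewrite mc md; split.
Qed.

Lemma tableau_ltP t u :
  reflect (exists j, [/\ j < width t, column_lt (column j t) (column j u)
                & forall k, j < k < width t -> column k t = column k u])
          (tableau_lt t u).
Proof.
apply: (iffP hasP) => -[j]; rewrite ?mem_iota ?add0n /=.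
  move=> jw /andP[lt_j /allP top]; exists j; split=> // k /andP[jk kw].
  by have := top k; rewrite mem_iota jk => /(_ kw)/eqP.
case=> jw lt_j top; exists j; rewrite ?mem_iota // lt_j; apply/allP => k.
by rewrite mem_iota => /= kw; apply/implyP => jk; rewrite top ?jk.
Qed.

Lemma widthE (T : eqType) (t : tableau T) : width t = \max_(n <- shape t) n.
Proof. by rewrite /width big_map. Qed.

Lemma tableau_ltxx t : tableau_lt t t = false.
Proof. by apply/tableau_ltP => -[j []]; rewrite column_ltxx. Qed.

Section InnerOrder.
Variables (mu : seq nat) (mu_sorted : sorted geq mu).

Lemma SSYT_shape t : SSYT mu t -> shape t = mu.
Proof. by case/andP=> /and3P[/eqP]. Qed.

(** The rightmost of the two columns that decide the given comparisons decides
    the composite one; if they coincide, columns are compared transitively. The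
    common shape makes the columns range over the same interval. *)
Lemma tableau_lt_trans : {in SSYT mu & &, transitive tableau_lt}.
Proof.
move=> u t v /SSYT_shape shu /SSYT_shape sht /SSYT_shape shv.
have wut : width u = width t by rewrite !widthE shu sht.
case/tableau_ltP=> i [iw tu eq_tu] /tableau_ltP[j]; rewrite wut => -[jw uv eq_uv].
apply/tableau_ltP; exists (maxn i j); split; first by rewrite gtn_max iw.
  case: (ltngtP i j) => ij; last by subst j; apply: column_lt_trans tu uv.
    by rewrite eq_tu ?ij.
  by rewrite -eq_uv ?ij.
move=> k /andP[]; rewrite gtn_max => /andP[ik jk] kw.
by rewrite eq_tu ?eq_uv ?ik ?jk.
Qed.

Lemma SSYT_columns t j : SSYT mu t -> sorted ltn (column j t).
Proof.
move=> t_ssyt; case/andP: (t_ssyt) => /and3P[/eqP sh _ /allP cols] _.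
have [jw | wj] := ltnP j (width t); first by apply: cols; rewrite mem_iota.
rewrite (columnE 0) ?sh //; have := @ltn_col_height _ t 0 j.
rewrite sh => /(_ mu_sorted); case: (count _ t) => // n /esym/ltn_width.
by rewrite ltnNge wj.
Qed.

(** Two different tableaux of the same shape differ in some column, and the
    rightmost such column decides. *)
Lemma tableau_lt_total :
  {in SSYT mu &, forall t u, t != u -> tableau_lt t u || tableau_lt u t}.
Proof.
move=> t u t_ssyt u_ssyt neq_tu.
have [sht shu] := (SSYT_shape t_ssyt, SSYT_shape u_ssyt).
have wut : width u = width t by rewrite !widthE shu sht.
pose D j := (j < width t) && (column j t != column j u).
have exD : exists j, D j.
  suff /hasP[j] : has (fun j => column j t != column j u) (iota 0 (width t)).
    by rewrite mem_iota => jw Dj; exists j; rewrite /D Dj andbT.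
  apply: contraR neq_tu => /hasPn eq_tu; apply/eqP.
  apply: (tableau_ext 0); rewrite ?sht ?shu // => j jw.
  by apply/eqP/negPn/eq_tu; rewrite mem_iota.
have ubD j : D j -> j <= width t by case/andP=> /ltnW.
case: (ex_maxnP exD ubD) => m /andP[mw m_diff] max_m.
have top k : m < k < width t -> column k t = column k u.
  case/andP=> mk kw; apply/eqP; apply: contraTT mk => k_diff.
  by rewrite -leqNgt max_m // /D kw.
have [col_t col_u] := (SSYT_columns m t_ssyt, SSYT_columns m u_ssyt).
have /orP[lt_m|lt_m] := column_lt_total col_t col_u m_diff.
  by apply/orP; left; apply/tableau_ltP; exists m.
by apply/orP; right; apply/tableau_ltP; exists m; rewrite wut; split=> // k /top.
Qed.

End InnerOrder.

(** * Bender-Knuth involutions on tableaux of natural numbers *)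

Definition below k (r : seq nat) := count (fun x => x < k) r.

Lemma leq_below k l r : k <= l -> below k r <= below l r.
Proof. by move=> kl; apply: sub_count => x /= xk; apply: leq_trans kl. Qed.

Lemma below_size k r : below k r <= size r. Proof. exact: count_size. Qed.

Lemma count_mem_below k r : below k.+1 r = below k r + count_mem k r.
Proof. by elim: r => //= x r ->; lia. Qed.

Lemma count_mem_belowB k r : count_mem k r = below k.+1 r - below k r.
Proof. by rewrite count_mem_below addnC addnK. Qed.

(** In a weakly increasing row the entries less than k form a prefix, so the
    counts below and the entries of the row determine each other. *)
Lemma nth_below r j k : sorted leq r -> j < size r ->
  (nth 0 r j < k) = (j < below k r).
Proof.
elim: r j => [//|x r IH] j /= r_sorted.
have := IH _ (path_sorted r_sorted); rewrite (path_sortedE leq_trans) in r_sorted.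
case/andP: r_sorted => /allP x_min _ {}IH; rewrite ltnS.
have [xk | kx] := ltnP x k; first by case: j => // j /IH ->.
have -> : below k r = 0.
  apply/eqP; rewrite -leqn0 leqNgt -has_count; apply/hasPn => y /x_min xy.
  by rewrite -leqNgt (leq_trans kx).
case: j => [|j] jr /=; first by rewrite [LHS]ltnNge kx.
by rewrite [LHS]ltnNge (leq_trans kx) // x_min ?mem_nth.
Qed.

Lemma eq_sorted_below r s : sorted leq r -> sorted leq s ->
  (forall k, below k r = below k s) -> r = s.
Proof.
move=> r_sorted s_sorted eq_rs; apply: (sorted_eq leq_trans anti_leq) => //.
apply/allP=> x _ /=; apply/eqP/(@addnI (below x r)).
by rewrite -count_mem_below !eq_rs count_mem_below.
Qed.

(** Column strictness as the interlacing condition on Gelfand-Tsetlin patterns: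
    the entries at most k of a row lie strictly under entries less than k of the
    previous row. *)
Lemma semistandard_belowP la t : sorted geq la ->
  reflect [/\ shape t = la, all (sorted leq) t
            & forall i k, below k.+1 (nth [::] t i.+1) <= below k (nth [::] t i)]
          (semistandard ltn la t).
Proof.
move=> la_sorted.
have le_rows : all (sorted (fun x y => (x == y) || ltn x y)) t = all (sorted leq) t.
  by apply: eq_all => r; apply: eq_sorted => x y /=; rewrite -leq_eqVlt.
suff cols_eq : shape t = la -> all (sorted leq) t ->
    (forall i j, j < size (nth [::] t i.+1) -> entry 0 t i j < entry 0 t i.+1 j)
    <-> (forall i k, below k.+1 (nth [::] t i.+1) <= below k (nth [::] t i)).
  apply: (iffP (semistandardP 0 ltn t la_sorted)) => -[sh];
    rewrite ?le_rows => rows cols; split; rewrite ?le_rows //; exact/cols_eq.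
move=> sh rows.
have row_sorted i : sorted leq (nth [::] t i).
  by have [/(all_nthP [::] rows)|/(nth_default _)->] := ltnP i (size t).
have row_size i : size (nth [::] t i.+1) <= size (nth [::] t i).
  rewrite -!nth_shape sh; have [it|it] := ltnP i.+1 (size la).
    by move/(sortedP 0): la_sorted; apply.
  by rewrite nth_default.
split=> cols i => [k|j jr]; last first.
  rewrite /entry nth_below ?(leq_trans jr (row_size i)) //.
  by apply: leq_trans (cols i (entry 0 t i.+1 j)); rewrite -nth_below ?leqnn.
case def_m: (below k.+1 _) => [//|m].
have m_in : m < size (nth [::] t i.+1) by rewrite -def_m below_size.
rewrite -nth_below ?(leq_trans m_in (row_size i)) //.
by apply: leq_trans (cols _ _ m_in) _; rewrite -ltnS nth_below // def_m.
Qed.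

Section ToggleRow.
Variables (b m : nat) (r : seq nat).
Hypothesis (bm : below b r <= m) (mb : m <= below b.+2 r).

(** The row in which the entries b and b + 1 of r are redistributed so that m
    entries are less than b + 1. Sorting makes weak increase hold by construction,
    so that only counts remain to be checked. *)
Definition toggle_row :=
  sort leq ([seq x <- r | x < b] ++ nseq (m - below b r) b
              ++ nseq (below b.+2 r - m) b.+1 ++ [seq x <- r | b.+1 < x]).

Lemma count_toggle_row (a : pred nat) :
  count a toggle_row = count (fun x => a x && (x < b)) r + a b * (m - below b r)
    + a b.+1 * (below b.+2 r - m) + count (fun x => a x && (b.+1 < x)) r.
Proof.
rewrite (permP (permEl (perm_sort _ _))).
by rewrite !count_cat !count_nseq !count_filter !addnA.
Qed.

Lemma count_split3 (a : pred nat) : count a r = count (fun x => a x && (x < b)) r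
  + a b * (below b.+1 r - below b r) + a b.+1 * (below b.+2 r - below b.+1 r)
  + count (fun x => a x && (b.+1 < x)) r.
Proof.
rewrite -!count_mem_belowB.
elim: r => [|x s IH] /=; first by rewrite !muln0.
rewrite IH; case: (ltngtP x b) => [xb|xb|xb];
  case: (ltngtP x b.+1) => [xc|xc|xc] //=; try lia.
  by rewrite xc; lia.
by rewrite xb; lia.
Qed.

Lemma size_toggle_row : size toggle_row = size r.
Proof.
rewrite -!(count_predT _) count_toggle_row (count_split3 predT) /=.
by move: (@leq_below b b.+1 r) (@leq_below b.+1 b.+2 r); lia.
Qed.

Lemma below_toggle_row k :
  below k toggle_row = if k == b.+1 then m else below k r.
Proof.
have [le_b le_b1] := (leq_below r (leqnSn b), leq_below r (leqnSn b.+1)).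
case: eqP => [->|k_neq]; last first.
  rewrite /below count_toggle_row [in RHS](count_split3 (fun x => x < k)) /=.
  by lia.
rewrite /below count_toggle_row ltnSn ltnn mul1n mul0n addn0.
rewrite (eq_count (a2 := fun x => x < b)); last by move=> x /=; lia.
rewrite [X in _ + X](eq_count (a2 := pred0)) ?count_pred0; last by move=> x /=; lia.
by rewrite -/(below b r) addn0 subnKC.
Qed.

Lemma sorted_toggle_row : sorted leq toggle_row.
Proof. exact: sort_sorted leq_total _. Qed.

End ToggleRow.

Section BenderKnuth.
Variable b : nat.
Implicit Types t : tableau nat.

(** The row g(b+1, .) of the pattern is constrained only by its neighbours g(b, .)
    and g(b+2, .): interlacing and weak increase in k confine g(b+1, i) to the
    interval from toggle_min t i to toggle_max t i. The first row has nothing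
    above it, which accounts for the case distinction. *)
Definition toggle_max t i := if i is i'.+1
  then minn (below b.+2 (nth [::] t i)) (below b (nth [::] t i'))
  else below b.+2 (nth [::] t 0).

Definition toggle_min t i :=
  maxn (below b.+2 (nth [::] t i.+1)) (below b (nth [::] t i)).

(** The reflection of g(b+1, i) in that interval. The truncated subtraction is
    harmless when t is semistandard, as then g(b+1, i) is at most
    toggle_max t i. *)
Definition toggle_below t i :=
  toggle_max t i + toggle_min t i - below b.+1 (nth [::] t i).

Definition bender_knuth t : tableau nat :=
  mkseq (fun i => toggle_row b (toggle_below t i) (nth [::] t i)) (size t).

Section OneTableau.
Variables (la : seq nat) (t : tableau nat).
Hypotheses (la_sorted : sorted geq la) (t_ss : semistandard ltn la t).

Let cols i k : below k.+1 (nth [::] t i.+1) <= below k (nth [::] t i).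
Proof. by case/(semistandard_belowP _ la_sorted): t_ss. Qed.

Lemma toggle_min_le i : toggle_min t i <= below b.+1 (nth [::] t i).
Proof. by rewrite geq_max cols leq_below. Qed.

Lemma toggle_max_ge i : below b.+1 (nth [::] t i) <= toggle_max t i.
Proof. by case: i => [|i] /=; rewrite ?leq_min ?cols leq_below. Qed.

Lemma toggle_below_ge i : toggle_min t i <= toggle_below t i.
Proof. by rewrite /toggle_below; move: (toggle_max_ge i); lia. Qed.

Lemma toggle_below_le i : toggle_below t i <= toggle_max t i.
Proof. by rewrite /toggle_below; move: (toggle_min_le i); lia. Qed.

Lemma toggle_below_bounds i :
  below b (nth [::] t i) <= toggle_below t i <= below b.+2 (nth [::] t i).
Proof.
rewrite (leq_trans (leq_maxr _ _) (toggle_below_ge i)).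
apply: leq_trans (toggle_below_le i) _.
by case: i => [|i] //=; rewrite geq_minl.
Qed.

Lemma nth_bender_knuth i :
  nth [::] (bender_knuth t) i = toggle_row b (toggle_below t i) (nth [::] t i).
Proof.
have [it|it] := ltnP i (size t); first by rewrite nth_mkseq.
rewrite !nth_default ?size_mkseq //.
have /andP[_] := toggle_below_bounds i; rewrite nth_default //= leqn0 => /eqP ->.
by [].
Qed.

Lemma below_bender_knuth i k : below k (nth [::] (bender_knuth t) i) =
  if k == b.+1 then toggle_below t i else below k (nth [::] t i).
Proof.
rewrite nth_bender_knuth; case/andP: (toggle_below_bounds i) => *.
exact: below_toggle_row.
Qed.

Lemma bender_knuth_semistandard : semistandard ltn la (bender_knuth t).
Proof.
apply/(semistandard_belowP _ la_sorted); split.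
- case/(semistandard_belowP _ la_sorted): t_ss => <- _ _.
  apply: (@eq_from_nth _ 0); rewrite !size_map ?size_iota // => i it.
  rewrite nth_shape nth_bender_knuth nth_shape.
  by case/andP: (toggle_below_bounds i) => *; apply: size_toggle_row.
- by apply/allP=> _ /mapP[i _ ->]; apply: sorted_toggle_row.
move=> i k; rewrite !below_bender_knuth; have := cols i k.
have := toggle_below_le i.+1; have := toggle_below_ge i.
rewrite eqSS /= /toggle_min geq_max leq_min => /andP[ge2 geb] /andP[le2 leb].
by case: eqP => [->|_]; case: eqP => [|_] //; [lia | move=> -> ].
Qed.

Lemma below_flatten k (u : tableau nat) :
  below k (flatten u) = \sum_(0 <= i < size u) below k (nth [::] u i).
Proof. by rewrite /below count_flatten sumnE big_map (big_nth [::]). Qed.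

(** The minimum in toggle_max t i.+1 and the maximum in toggle_min t i are taken
    over the same two numbers, so together they contribute the sum of the two.
    The upper bound for the first row and the lower bound for the last row
    remain; the latter is kept explicit so that the induction on m works. *)
Lemma sum_toggle_bounds m :
  \sum_(0 <= i < m.+1) (toggle_max t i + toggle_min t i)
    + below b (nth [::] t m)
  = \sum_(0 <= i < m.+1) (below b.+2 (nth [::] t i) + below b (nth [::] t i))
    + toggle_min t m.
Proof.
elim: m => [|m IH]; first by rewrite !big_nat1 /=; lia.
rewrite big_nat_recr // [in RHS]big_nat_recr //=; move: IH.
have := addn_min_max (below b.+2 (nth [::] t m.+1)) (below b (nth [::] t m)).
by rewrite -/(toggle_max t m.+1) -/(toggle_min t m) /=; lia.
Qed.

(** Reflection replaces the total of g(b+1, .) by the sum of both interval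
    endpoints minus it. The row under the last one is empty, so the boundary term
    of sum_toggle_bounds disappears. *)
Lemma below_flatten_bender_knuth :
  below b.+1 (flatten (bender_knuth t)) + below b.+1 (flatten t)
  = below b.+2 (flatten t) + below b (flatten t).
Proof.
rewrite !below_flatten size_mkseq -!big_split /=.
transitivity (\sum_(0 <= i < size t) (toggle_max t i + toggle_min t i)).
  apply: eq_bigr => i _; rewrite below_bender_knuth eqxx subnK //.
  exact: leq_trans (toggle_max_ge i) (leq_addr _ _).
case n_def: (size t) => [|n]; first by rewrite !big_geq.
apply: (@addIn (below b (nth [::] t n))); rewrite sum_toggle_bounds.
by rewrite /toggle_min [nth [::] t n.+1]nth_default ?n_def ?max0n.
Qed.

Lemma below_flatten_bender_knuth_neq k : k != b.+1 ->
  below k (flatten (bender_knuth t)) = below k (flatten t).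
Proof.
move=> /negPf k_neq; rewrite !below_flatten size_mkseq; apply: eq_bigr => i _.
by rewrite below_bender_knuth k_neq.
Qed.

Definition adjacent_swap k := if k == b then b.+1 else if k == b.+1 then b else k.

Lemma count_bender_knuth k :
  count_mem k (flatten (bender_knuth t)) = count_mem (adjacent_swap k) (flatten t).
Proof.
have le_b := leq_below (flatten t) (leqnSn b).
have le_b1 := leq_below (flatten t) (leqnSn b.+1).
have tot := below_flatten_bender_knuth; have other := below_flatten_bender_knuth_neq.
rewrite /adjacent_swap !count_mem_belowB; case: (eqVneq k b) => [->|kb].
  by rewrite (other b); lia.
case: (eqVneq k b.+1) => [->|kb1]; first by rewrite (other b.+2); lia.
by rewrite !other // eqSS.
Qed.

End OneTableau.

(** The interval of reflection depends on g(b, .) and g(b+2, .) only, and these are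
    unchanged; so the second reflection undoes the first. *)
Lemma bender_knuthK la t : sorted geq la -> semistandard ltn la t ->
  bender_knuth (bender_knuth t) = t.
Proof.
move=> la_sorted t_ss; have bk_ss := bender_knuth_semistandard la_sorted t_ss.
apply: (@eq_from_nth _ [::]); first by rewrite !size_mkseq.
move=> i; rewrite !size_mkseq => it; apply: eq_sorted_below.
- rewrite (nth_bender_knuth la_sorted bk_ss); exact: sorted_toggle_row.
- by case/(semistandard_belowP _ la_sorted): t_ss => _ /(all_nthP [::])/(_ i it).
move=> k; rewrite (below_bender_knuth la_sorted bk_ss).
rewrite (below_bender_knuth la_sorted t_ss); case: eqP => // ->.
have same j l : l != b.+1 ->
    below l (nth [::] (bender_knuth t) j) = below l (nth [::] t j).
  by move=> /negPf l_neq; rewrite (below_bender_knuth la_sorted t_ss) l_neq.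
have eq_max : toggle_max (bender_knuth t) i = toggle_max t i.
  by case: i it => [|i] _; rewrite /toggle_max !same //; lia.
have eq_min : toggle_min (bender_knuth t) i = toggle_min t i.
  by rewrite /toggle_min !same //; lia.
rewrite {1}/toggle_below eq_max eq_min (below_bender_knuth la_sorted t_ss) eqxx.
have := toggle_max_ge la_sorted t_ss i; rewrite /toggle_below; lia.
Qed.

End BenderKnuth.

(** For b > 0 the multiplicity of 0 stays zero, so positive entries remain
    positive. *)
Lemma SSYT_bender_knuth mu b t : sorted geq mu -> 0 < b -> SSYT mu t ->
  SSYT mu (bender_knuth b t).
Proof.
move=> mu_sorted b_gt0 /andP[t_ss t_pos]; apply/andP; split.
  exact: bender_knuth_semistandard.
have count0 (u : tableau nat) : all (leq 1) (flatten u) = (count_mem 0 (flatten u) == 0).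
  elim: (flatten u) => //= x v ->; lia.
move: t_pos; rewrite !count0 (count_bender_knuth b mu_sorted t_ss).
by rewrite /adjacent_swap; case: b b_gt0.
Qed.

Lemma bender_knuth_inj mu b : sorted geq mu -> {in SSYT mu &, injective (bender_knuth b)}.
Proof.
move=> mu_sorted t u /andP[t_ss _] /andP[u_ss _] eq_tu.
by rewrite -(bender_knuthK b mu_sorted t_ss) eq_tu (bender_knuthK b mu_sorted u_ss).
Qed.

(** * Permuting the content of a semistandard tableau *)

(** Adjacent transpositions generate all permutations. The first element of d is
    moved to the front of c step by step; the prefix s in front of both lists
    makes the induction go through. *)
Lemma perm_eq_swap_ind (T : eqType) (P : seq T -> Prop) :
    (forall s x y r, P (s ++ x :: y :: r) -> P (s ++ y :: x :: r)) ->
  forall c d, perm_eq c d -> P c -> P d.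
Proof.
move=> swapP c d; rewrite -[c]cat0s -[d]cat0s perm_cat2l.
elim: d [::] c => [|x d IH] s c; first by move/perm_nilP->.
move=> eq_cd; have xc : x \in c by rewrite (perm_mem eq_cd) mem_head.
case/splitPr: xc eq_cd => c1 c2; rewrite -[x :: c2]cat1s perm_catCA perm_cons.
move=> eq_cd Pc; rewrite -cat_rcons; apply: IH eq_cd _.
rewrite cat_rcons; elim/last_ind: c1 c2 Pc => [//|c1 y IHc] c2.
by rewrite !cat_rcons catA => /swapP; rewrite -catA => /IHc.
Qed.

Lemma nth_swap (s r : seq nat) x y k :
  nth 0 (s ++ y :: x :: r) k = nth 0 (s ++ x :: y :: r) (adjacent_swap (size s) k).
Proof.
rewrite /adjacent_swap !nth_cat; case: (ltngtP k (size s)) => [ks|sk|->].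
- by rewrite (ltn_eqF (ltnW _)) ?ks.
- case: (eqVneq k (size s).+1) => [->|k_neq]; first by rewrite ltnn subSnn subnn.
  rewrite ltnNge (ltnW sk) /=.
  by case def_k: (k - size s) => [|[|n]] //; lia.
by rewrite ltnNge leqnSn subnn subSnn.
Qed.

Definition has_content la (c : seq nat) (t : tableau nat) :=
  semistandard ltn la t /\ forall k, count_mem k (flatten t) = nth 0 c k.

(** Symmetry of Kostka numbers in the content, as an existence statement. *)
Lemma content_perm la c d : sorted geq la -> perm_eq c d ->
  (exists t, has_content la c t) -> exists t, has_content la d t.
Proof.
move=> la_sorted.
apply: (perm_eq_swap_ind (P := fun c => exists t, has_content la c t)).
move=> s x y r [t [t_ss t_cont]]; exists (bender_knuth (size s) t).
split; first exact: (bender_knuth_semistandard _ la_sorted).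
by move=> k; rewrite (count_bender_knuth _ la_sorted t_ss) t_cont -nth_swap.
Qed.

Lemma column_map (T1 T2 : eqType) (f : T1 -> T2) j (t : tableau T1) :
  column j (map (map f) t) = map f (column j t).
Proof.
by elim: t => //= r t IH; rewrite onth_map; case: (onth r j) => //= x; rewrite IH.
Qed.

Lemma column_sub (T : eqType) j (t : tableau T) : {subset column j t <= flatten t}.
Proof.
move=> x; elim: t => //= r t IH; rewrite mem_cat.
case def_y: (onth r j) => [y|] /=; rewrite ?inE.
  by case/predU1P=> [->|/IH ->]; rewrite ?orbT // (introT onthP) //; exists j.
by move/IH ->; rewrite orbT.
Qed.

Lemma shape_map (T1 T2 : Type) (f : T1 -> T2) (t : seq (seq T1)) :
  shape (map (map f) t) = shape t.
Proof. by rewrite /shape -map_comp; apply: eq_map => r /=; rewrite size_map. Qed.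

Lemma semistandard_map (T1 T2 : eqType) (f : T1 -> T2) (lt1 : rel T1)
    (lt2 : rel T2) la (t : tableau T1) :
    {in flatten t &, {homo f : x y / lt1 x y >-> lt2 x y}} ->
  semistandard lt1 la t -> semistandard lt2 la (map (map f) t).
Proof.
move=> f_homo /and3P[/eqP sh /allP rows /allP cols]; apply/and3P; split.
- by rewrite shape_map sh.
- apply/allP=> _ /mapP[r rt ->]; have := rows r rt.
  apply: (homo_sorted_in (P := mem (flatten t))) => [x y xt yt|].
    by case/orP=> [/eqP->|/f_homo->]; rewrite ?eqxx ?orbT.
  by apply/allP=> x xr; apply/flattenP; exists r.
apply/allP=> j; rewrite widthE shape_map -widthE => /cols; rewrite column_map.
by apply: (homo_sorted_in f_homo); apply/allP=> x /column_sub.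
Qed.

Section PermuteEntries.
Variables (T : eqType) (lt : rel T) (S : pred T).
Hypotheses (ltxx : irreflexive lt) (lt_tr : {in S & &, transitive lt})
  (lt_total : {in S &, forall x y, x != y -> lt x y || lt y x}).

Lemma exists_strict_sort s : all S s -> uniq s ->
  exists2 s', perm_eq s' s & sorted lt s'.
Proof.
move=> sS s_uniq; pose le x y := (x == y) || lt x y.
have le_total : {in S &, total le}.
  move=> x y xS yS; rewrite /le [y == x]eq_sym; case: eqVneq => //= xy.
  exact: lt_total.
exists (sort le s); first exact: permEl (perm_sort _ _).
have := sort_sorted_in le_total sS; have: uniq (sort le s) by rewrite sort_uniq.
case: (sort le s) => [//|x0 r] r_uniq /(sortedP x0) r_sorted.
apply/(sortedP x0) => i ir; have := r_sorted i ir.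
by rewrite /le nth_uniq ?(ltnW ir) // ltn_eqF.
Qed.

Variables (f : T -> T) (nu : seq nat).
Hypotheses (f_stable : forall x, S x -> S (f x)) (f_inj : {in S &, injective f})
  (nu_sorted : sorted geq nu).

(** Only the multiplicities matter for the existence of a semistandard tableau:
    with the distinct entries of t listed increasingly as s, and their images
    increasingly as s', the multiplicities along s and along s' are permutations
    of each other because f is injective. The tableau of ranks of t is
    converted by content_perm and the ranks are then read in s'. *)
Lemma semistandard_permute_entries (t : tableau T) :
    semistandard lt nu t -> all S (flatten t) ->
  exists t', semistandard lt nu t' /\ perm_eq (flatten t') (map f (flatten t)).
Proof.
move=> t_ss tS; set w := flatten t.
case def_w: w => [|x0 w'].
  by exists t; rewrite -/w def_w.
rewrite -{w'}def_w; have undupS : all S (undup w).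
  by apply/allP=> x; rewrite mem_undup => /(allP tS).
have [s s_perm s_sorted] := exists_strict_sort undupS (undup_uniq w).
have s_mem : s =i w by move=> x; rewrite (perm_mem s_perm) mem_undup.
have s_uniq : uniq s by rewrite (perm_uniq s_perm) undup_uniq.
have sS x : x \in s -> S x by rewrite s_mem => /(allP tS).
have fsS : all S (map f s) by apply/allP=> _ /mapP[x /sS/f_stable xS ->].
have f_inj_s : {in s &, injective f} by move=> x y /sS xS /sS yS; apply: f_inj.
have fs_uniq : uniq (map f s) by rewrite map_inj_in_uniq.
have [s' s'_perm s'_sorted] := exists_strict_sort fsS fs_uniq.
have s'_uniq : uniq s' by rewrite (perm_uniq s'_perm).
have s'S : all S s' by rewrite (perm_all _ s'_perm).
pose c := [seq count_mem x w | x <- s].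
pose d := [seq count_mem y (map f w) | y <- s'].
have eq_cd : perm_eq c d.
  rewrite perm_sym; apply: perm_trans (perm_map _ s'_perm) _.
  rewrite -map_comp (eq_in_map _ (fun x => count_mem x w) _).1 // => x xs /=.
  rewrite count_map; apply: eq_in_count => y yw /=.
  by apply/eqP/eqP=> [/f_inj_s-> //|->] //; rewrite s_mem.
have [N [N_ss N_cont]] : exists N, has_content nu c N.
  exists (map (map (index^~ s)) t); split.
    apply: semistandard_map t_ss => x y xw yw xy; rewrite /= ltnNge.
    have [xs ys] : x \in s /\ y \in s by rewrite !s_mem.
    apply/negP; rewrite leq_eqVlt => /orP[/eqP eq_xy|lt_yx].
      by move: xy; rewrite -[x](nth_index x0 xs) -eq_xy nth_index ?ltxx.
    have s_tr : {in s & &, transitive lt}.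
      by move=> a b e /sS aS /sS bS /sS eS; apply: lt_tr.
    have yx := sorted_ltn_index_in s_tr s_sorted _ _ ys xs lt_yx.
    by have := s_tr _ _ _ ys xs xs xy yx; rewrite ltxx.
  move=> k; rewrite -map_flatten count_map -/w.
  have [ks|sk] := ltnP k (size s).
    rewrite (nth_map x0) //; apply: eq_in_count => x xw /=.
    have xs : x \in s by rewrite s_mem.
    by apply/eqP/eqP=> [<-|->]; rewrite ?nth_index ?index_uniq.
  rewrite nth_default ?size_map //; apply/eqP; rewrite -leqn0 leqNgt -has_count.
  apply/hasPn=> x xw /=; rewrite neq_ltn (leq_trans _ sk) //.
  by rewrite index_mem s_mem.
have [M [M_ss M_cont]] := content_perm nu_sorted eq_cd (ex_intro _ N (conj N_ss N_cont)).
have M_lt k : k \in flatten M -> k < size s'.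
  rewrite -has_pred1 has_count M_cont [k < _]ltnNge; apply: contraL => sk.
  by rewrite nth_default ?size_map.
exists (map (map (nth x0 s')) M); split.
  apply: semistandard_map M_ss => i j /M_lt i_lt /M_lt j_lt.
  exact: (sorted_ltn_nth_in lt_tr x0 s'S s'_sorted).
rewrite -map_flatten; apply/allP => y _ /=; rewrite count_map; apply/eqP.
have [ys|ys] := boolP (y \in s').
  rewrite -(nth_index x0 ys); have := M_cont (index y s').
  rewrite (nth_map x0) ?index_mem // => <-; apply: eq_in_count => k /M_lt ks /=.
  by rewrite nth_uniq ?index_mem.
have -> : count_mem y (map f w) = 0.
  apply/count_memPn; apply: contra ys => /mapP[x xw ->].
  by rewrite (perm_mem s'_perm) map_f // s_mem.
apply/eqP; rewrite -leqn0 leqNgt -has_count; apply/hasPn=> k /M_lt ks /=.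
by apply: contraNneq ys => <-; rewrite mem_nth.
Qed.

End PermuteEntries.

(** * Weights of plethystic tableaux *)

Lemma partition_sorted p : is_partition p -> sorted geq p.
Proof. by case/andP. Qed.

Lemma count_flatten_flatten (S : Type) (a : pred S) (ts : seq (seq (seq S))) :
  count a (flatten (flatten ts)) = sumn [seq count a (flatten t) | t <- ts].
Proof. by elim: ts => //= t ts IH; rewrite flatten_cat count_cat IH. Qed.

(** The plethysm of two Schur functions is symmetric, in the form of an existence
    statement: the involution on inner tableaux exchanges the multiplicities,
    and the outer tableau is rebuilt around the new entries. *)
Lemma plethystic_adjacent_swap mu nu b T :
    is_partition mu -> is_partition nu -> 0 < b ->
    plethystic_semistandard mu nu T ->
  exists2 T', plethystic_semistandard mu nu T' &
    forall k, count_mem k (entries T') = count_mem (adjacent_swap b k) (entries T).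
Proof.
move=> /partition_sorted mu_sorted /partition_sorted nu_sorted b_gt0 /andP[T_ss T_mu].
have bk_mu t : SSYT mu t -> SSYT mu (bender_knuth b t) by apply: SSYT_bender_knuth.
have [T' [T'_ss T'_perm]] := semistandard_permute_entries tableau_ltxx
  (@tableau_lt_trans mu) (tableau_lt_total mu_sorted) bk_mu
  (bender_knuth_inj (b := b) mu_sorted) nu_sorted T_ss T_mu.
exists T'.
  apply/andP; split=> //; rewrite (perm_all _ T'_perm).
  by apply/allP=> _ /mapP[t /(allP T_mu) /bk_mu tS ->].
move=> k; rewrite /entries !count_flatten_flatten.
rewrite (perm_sumn (perm_map _ T'_perm)) -map_comp; congr sumn.
apply/eq_in_map => t /(allP T_mu)/andP[t_ss _] /=.
exact: count_bender_knuth t_ss _.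
Qed.

Lemma nth_wt T k : nth 0 (wt T) k = count_mem k.+1 (entries T).
Proof.
rewrite /wt; set M := \max_(x <- _) x; have [kM|Mk] := ltnP k M.
  by rewrite (nth_map 0) ?size_iota // nth_iota.
rewrite nth_default ?size_map ?size_iota //; apply/esym/count_memPn.
apply: contraTN Mk => kT; rewrite -ltnNge /M.
by rewrite (big_rem _ kT) leq_max leqnn.
Qed.

Lemma sumn_takeS (s : seq nat) i : sumn (take i.+1 s) = sumn (take i s) + nth 0 s i.
Proof.
have [si|si] := ltnP i (size s).
  by rewrite (take_nth 0) // -cats1 sumn_cat /= addn0.
by rewrite nth_default // !take_oversize ?addn0 // ltnW.
Qed.

Lemma dominates_swap (beta gamma : seq nat) b :
    nth 0 gamma b <= nth 0 gamma b.+1 ->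
    (forall k, nth 0 beta k = nth 0 gamma (adjacent_swap b k)) ->
  dominates beta gamma.
Proof.
move=> asc swap i.
suff: sumn (take i beta) = sumn (take i gamma)
        + (i == b.+1) * (nth 0 gamma b.+1 - nth 0 gamma b).
  by move=> ->; rewrite leq_addr.
(* The partial sums differ only after b + 1 terms, by the difference exchanged. *)
elim: i => [|i IH]; first by rewrite !take0.
rewrite !sumn_takeS {}IH swap /adjacent_swap eqSS.
case: (eqVneq i b) => [->|ib]; first by rewrite ltn_eqF //; lia.
by case: (eqVneq i b.+1) => [->|_]; lia.
Qed.

(** The last part of the weight counts the greatest entry, which occurs. *)
Lemma wt_pos T : wt T != [::] -> 0 < nth 0 (wt T) (size (wt T)).-1.
Proof.
rewrite -size_eq0 nth_wt size_map size_iota; case def_M: (\max_(x <- _) x) => [//|M] _.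
rewrite -has_count has_pred1 /= -def_M.
have: \max_(x <- entries T) x > 0 by rewrite def_M.
elim: (entries T) => [|x s IH]; first by rewrite big_nil.
rewrite big_cons inE /maxn; case: ifP => [_ /IH ->|_ _]; rewrite ?eqxx ?orbT //.
Qed.

Theorem corollary7p3 (mu nu : seq nat) (T : tableau (tableau nat))
    (mu_part : is_partition mu) (nu_part : is_partition nu)
    (T_pss : plethystic_semistandard mu nu T)
    (wt_maximal : forall T' : tableau (tableau nat),
       plethystic_semistandard mu nu T' ->
       dominates (wt T') (wt T) -> wt T' = wt T) :
  is_partition (wt T).
Proof.
have wt_sorted : sorted geq (wt T).
  apply/(sortedP 0) => b _ /=; rewrite leqNgt; apply/negP => asc.
  have [T' T'_pss T'_count] := plethystic_adjacent_swap mu_part nu_part (ltn0Sn b) T_pss.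
  have swap k : nth 0 (wt T') k = nth 0 (wt T) (adjacent_swap b k).
    by rewrite !nth_wt T'_count /adjacent_swap !eqSS; case: ifP => // _; case: ifP.
  have /(congr1 (nth 0 ^~ b)) /= := wt_maximal T' T'_pss (dominates_swap (ltnW asc) swap).
  by rewrite swap /adjacent_swap eqxx => eq_b; rewrite eq_b ltnn in asc.
rewrite /is_partition wt_sorted; apply/negP => /(nthP 0)[k k_lt wt_k0].
have wt_neq0 : wt T != [::] by rewrite -size_eq0 -lt0n (leq_ltn_trans _ k_lt).
have geq_trans : transitive geq by move=> x y z /= yx xz; apply: leq_trans xz yx.
have last_lt : (size (wt T)).-1 < size (wt T) by rewrite prednK // (leq_ltn_trans _ k_lt).
have le_last : k <= (size (wt T)).-1 by rewrite -ltnS prednK // (leq_ltn_trans _ k_lt).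
have := sorted_leq_nth geq_trans leqnn 0 wt_sorted k _ k_lt last_lt le_last.
by rewrite /= wt_k0 leqn0 eqn0Ngt wt_pos.
Qed.
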